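(* Consider the partial differential equation \[ w_t + w^k w_z = w_{zz} + w\,(1 - w^n), \qquad w = w(z,t), \] with $n \in \{1,2\}$, $k$ a positive integer, and with the restriction that solutions satisfy $w \in [0,1]$. Then, for any given real $c \geq 2$, any $n \in \{1,2\}$ and any positive integer $k$, this equation has a traveling wave solution $w(z,t) = \phi(z - ct)$, with profile $\phi:\mathbb{R}\to[0,1]$, corresponding to a solution $(\phi(\xi),\psi(\xi))$, $\xi\in\mathbb{R}$, of the planar system \[ \phi' = \psi, \qquad \psi' = -c\,\psi + \phi^k \psi + \phi\,(\phi^n - 1) \] connecting the equilibrium points $(1,0)$ and $(0,0)$. The profile $\phi$ satisfies \[ \lim_{\xi \to -\infty} \phi(\xi) = 1, \quad \lim_{\xi \to +\infty} \phi(\xi) = 0, \quad \lim_{\xi \to -\infty} \phi'(\xi) = \lim_{\xi \to +\infty} \phi'(\xi) = 0. \]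
   Context: A traveling wave solution with velocity $c>0$ is a solution of the form $w(z,t)=\phi(\xi)$, $\xi = z - ct$. Such a $\phi$ must satisfy $-c\phi' + \phi^k\phi' = \phi'' + \phi(1-\phi^n)$, where the prime denotes the derivative with respect to $\xi$; setting $\psi=\phi'$ gives the planar system in the claim. A traveling wave solution is the first coordinate $\phi(\xi)$ of a solution $(\phi(\xi),\psi(\xi))$ of the planar system that tends to equilibrium points at both ends of its maximal interval of existence, subject to the restrictions imposed on solutions of the partial differential equation (here, values in $[0,1]$). *)

(* Defs.v *)
From Stdlib Require Import Reals.
From Coquelicot Require Import Coquelicot.
Open Scope R_scope.

(** Classical solutions [w z t], on the whole (z,t)-plane, of
    w_t + w^k w_z = w_zz + w (1 - w^n), restricted to values in [0,1]. *)
Definition pde_solution (k n : nat) (w : R -> R -> R) : Prop :=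
  (forall z t, 0 <= w z t <= 1) /\
  (forall z t, exists wt wz wzz : R,
     is_derive (fun s => w z s) t wt /\
     is_derive (fun y => w y t) z wz /\
     is_derive_n (fun y => w y t) 2 z wzz /\
     wt + w z t ^ k * wz = wzz + w z t * (1 - w z t ^ n)).

(** Right-hand side of the system obtained from w z t = phi (z - c t) and
    psi = phi'. *)
Definition planar_field (k n : nat) (c : R) (p : R * R) : R * R :=
  let (phi, psi) := p in
  (psi, - c * psi + phi ^ k * psi + phi * (phi ^ n - 1)).

Definition equilibrium (F : R * R -> R * R) (p : R * R) : Prop :=
  F p = (0, 0).

(** Solutions defined for all xi in R, hence automatically maximal. *)
Definition planar_solution (F : R * R -> R * R) (phi psi : R -> R) : Prop :=
  forall xi : R,
    is_derive phi xi (fst (F (phi xi, psi xi))) /\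
    is_derive psi xi (snd (F (phi xi, psi xi))).

(** The solution goes from [p] (at -infinity) to [q] (at +infinity). *)
Definition connects (F : R * R -> R * R) (phi psi : R -> R) (p q : R * R)
  : Prop :=
  equilibrium F p /\ equilibrium F q /\
  is_lim phi m_infty (fst p) /\ is_lim psi m_infty (snd p) /\
  is_lim phi p_infty (fst q) /\ is_lim psi p_infty (snd q).

(* Main.v *)
Require Import Defs.
From Stdlib Require Import Reals Lra ClassicalEpsilon.
From Coquelicot Require Import Coquelicot.
Open Scope R_scope.

(** On a decreasing orbit [psi = - p(phi)], and the parabola [p = u (1 - u)] is
    a barrier for every [c >= 2]: it suffices that [u^k <= u] on [[0,1]].
    Put [p(u) = u (1 - u) q] and parametrize [u] by the logistic curve
    [u(t) = 1 / (1 + e^t)]. The factor [q] then solves the nonsingular equation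
      [q' = (1 - 2 u) q - (c - u^k) + H(u) / q],  [H(u) = (1 - u^n) / (1 - u)],
    for which the strip [1/(c+1) <= q <= 1] is forward invariant, so it carries
    a solution defined on all of R. Since [du/dt = - u (1 - u)], the wave
    variable [xi] is recovered from [dt/dxi = q(t)], and [phi(xi) = u(t(xi))]. *)

(** * Consequences of the mean value theorem *)

Lemma is_derive_nonneg_le (f df : R -> R) (x y : R) :
  (forall t, is_derive f t (df t)) -> (forall t, 0 <= df t) ->
  x <= y -> f x <= f y.
Proof.
intros Hf Hdf Hxy.
destruct (MVT_gen f x y df) as [z [_ Hz]].
- intros t _; apply Hf.
- intros t _; apply derivable_continuous_pt; exists (df t).
  apply is_derive_Reals, Hf.
- generalize (Hdf z); nra.
Qed.

Lemma is_derive_lipschitz (f df : R -> R) (L x y : R) :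
  (forall t, is_derive f t (df t)) -> (forall t, Rabs (df t) <= L) ->
  Rabs (f y - f x) <= L * Rabs (y - x).
Proof.
intros Hf Hdf.
destruct (MVT_gen f x y df) as [z [_ Hz]].
- intros t _; apply Hf.
- intros t _; apply derivable_continuous_pt; exists (df t).
  apply is_derive_Reals, Hf.
- rewrite Hz, Rabs_mult.
  apply Rmult_le_compat_r; [apply Rabs_pos | apply Hdf].
Qed.

Lemma lipschitz_continuous (f : R -> R) (L : R) :
  (forall x y, Rabs (f y - f x) <= L * Rabs (y - x)) ->
  forall x, continuous f x.
Proof.
intros Hf x.
apply filterlim_locally; intros eps.
assert (HL : 0 < Rabs L + 1) by (generalize (Rabs_pos L); lra).
assert (Hd : 0 < eps / (Rabs L + 1)).
{ apply Rdiv_lt_0_compat; [apply cond_pos | exact HL]. }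
exists (mkposreal _ Hd); intros y Hy.
change (Rabs (y - x) < eps / (Rabs L + 1)) in Hy.
change (Rabs (f y - f x) < eps).
apply (Rmult_lt_compat_l (Rabs L + 1)) in Hy; [| exact HL].
replace ((Rabs L + 1) * (eps / (Rabs L + 1))) with (pos eps) in Hy
  by (field; lra).
generalize (Hf x y) (Rabs_pos (y - x)) (Rle_abs L); nra.
Qed.

(** * Bounded solutions of linear equations, and a monotone fixed point *)

(** As [exp (K t) z] is nondecreasing, a negative value of [z] grows exponentially in size backward
    in time, against the lower bound. Applied to a difference of two solutions, this is the
    comparison principle for bounded solutions of [y' + K y = G]. *)
Lemma bounded_linear_ode_nonneg (K B : R) (z dz : R -> R) :
  0 < K -> (forall t, is_derive z t (dz t)) ->
  (forall t, 0 <= dz t + K * z t) -> (forall t, - B <= z t) ->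
  forall t, 0 <= z t.
Proof.
intros HK Hz Hdz HB t.
destruct (Rle_or_lt 0 (z t)) as [H | H]; [exact H | exfalso].
assert (HB0 : 0 < B) by (generalize (HB t); lra).
(* With this [d], [K d (- z t) = B], so [exp (K d) > 1 + K d] yields [z (t - d) < z t - B < - B]. *)
set (d := B / (K * - z t)).
assert (Hd : 0 < d).
{ apply Rdiv_lt_0_compat; [exact HB0 | nra]. }
assert (Hmono : exp (K * (t - d)) * z (t - d) <= exp (K * t) * z t).
{ apply (is_derive_nonneg_le (fun s => exp (K * s) * z s)
          (fun s => exp (K * s) * (dz s + K * z s))).
  - intros s. auto_derive.
    + exists (dz s); apply Hz.
    + replace (Derive (fun x : R => z x) s) with (dz s)
        by (symmetry; apply is_derive_unique, Hz).
      ring.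
  - intros s; apply Rmult_le_pos; [left; apply exp_pos | apply Hdz].
  - lra. }
replace (K * t) with (K * (t - d) + K * d) in Hmono by ring.
rewrite exp_plus, Rmult_assoc in Hmono.
apply Rmult_le_reg_l in Hmono; [| apply exp_pos].
assert (Hexp := exp_ineq1 (K * d)).
assert (HKd : 0 < K * d) by nra.
specialize (Hexp ltac:(lra)).
assert (HKdz : K * d * - z t = B) by (unfold d; field; lra).
generalize (HB (t - d)); nra.
Qed.

Lemma is_derive_RInt_continuous (g : R -> R) (a t : R) :
  (forall s, continuous g s) -> is_derive (fun x : R => RInt g a x : R) t (g t).
Proof.
intros Hg.
apply (is_derive_RInt g (fun x => RInt g a x) a); [| apply Hg].
apply filter_forall; intros s.
apply (RInt_correct g a s), (ex_RInt_continuous g); intros; apply Hg.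
Qed.

(** The solution is [exp (- K t)] times the integral of [exp (K s) G s] from minus infinity to [t].
    To avoid an improper integral, the limit [m] of the primitive [J] at minus infinity is obtained
    as a cut: it lies above all values of [J - b exp (K t)] and below all values of
    [J - a exp (K t)]. *)
Lemma bounded_linear_ode (K a b : R) (G : R -> R) :
  0 < K -> a <= b -> (forall t, continuous G t) ->
  (forall t, K * a <= G t <= K * b) ->
  exists y : R -> R,
    (forall t, is_derive y t (G t - K * y t)) /\ (forall t, a <= y t <= b).
Proof.
intros HK Hab HG HGb.
set (g := fun s => exp (K * s) * G s).
assert (Hg : forall s, continuous g s).
{ intros s; apply (continuous_mult (fun s => exp (K * s)) G); [| apply HG].
  apply (ex_derive_continuous (fun s => exp (K * s))); auto_derive; easy. }
set (J := fun t : R => RInt g 0 t : R).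
assert (HJ : forall t, is_derive J t (g t)).
{ intros t; apply is_derive_RInt_continuous, Hg. }
assert (HJa : forall s t, s <= t ->
  J s - a * exp (K * s) <= J t - a * exp (K * t)).
{ intros s t Hst.
  apply (is_derive_nonneg_le (fun s => J s - a * exp (K * s))
          (fun s => g s - a * (K * exp (K * s)))); [| | exact Hst].
  - intros x; apply (is_derive_minus J (fun s => a * exp (K * s))); [apply HJ |].
    auto_derive; [easy | ring].
  - intros x; unfold g; generalize (HGb x) (exp_pos (K * x)); nra. }
assert (HJb : forall s t, s <= t ->
  b * exp (K * s) - J s <= b * exp (K * t) - J t).
{ intros s t Hst.
  apply (is_derive_nonneg_le (fun s => b * exp (K * s) - J s)
          (fun s => b * (K * exp (K * s)) - g s)); [| | exact Hst].
  - intros x; apply (is_derive_minus (fun s => b * exp (K * s)) J); [| apply HJ].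
    auto_derive; [easy | ring].
  - intros x; unfold g; generalize (HGb x) (exp_pos (K * x)); nra. }
assert (Hsep : forall s t, J t - b * exp (K * t) <= J s - a * exp (K * s)).
{ intros s t; generalize (exp_pos (K * s)) (exp_pos (K * t)); intros Es Et.
  destruct (Rle_or_lt s t) as [H | H].
  - generalize (HJb s t H); nra.
  - generalize (HJa t s (Rlt_le _ _ H)); nra. }
destruct (completeness (fun x => exists t, x = J t - b * exp (K * t)))
  as [m [Hub Hlub]].
{ exists (J 0 - a * exp (K * 0)); intros x [t ->]; apply Hsep. }
{ eexists; exists 0; reflexivity. }
exists (fun t => exp (- (K * t)) * (J t - m)); split.
- intros t. auto_derive.
  + exists (g t); apply HJ.
  + replace (Derive (fun x : R => J x) t) with (g t)
      by (symmetry; apply is_derive_unique, HJ).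
    unfold g; rewrite exp_Ropp.
    generalize (exp_pos (K * t)); intros; field; lra.
- intros t.
  assert (H1 : J t - b * exp (K * t) <= m) by (apply Hub; now exists t).
  assert (H2 : m <= J t - a * exp (K * t)).
  { apply Hlub; intros x [s ->]; apply Hsep. }
  assert (E : exp (- (K * t)) * exp (K * t) = 1).
  { rewrite <- exp_plus, Rplus_opp_l; apply exp_0. }
  generalize (exp_pos (- (K * t))) (exp_pos (K * t)); intros E1 E2.
  split.
  + replace a with (exp (- (K * t)) * (a * exp (K * t)))
      by (transitivity (a * (exp (- (K * t)) * exp (K * t))); [ring | rewrite E; ring]).
    apply Rmult_le_compat_l; lra.
  + replace b with (exp (- (K * t)) * (b * exp (K * t)))
      by (transitivity (b * (exp (- (K * t)) * exp (K * t))); [ring | rewrite E; ring]).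
    apply Rmult_le_compat_l; lra.
Qed.

(* The map taking [r] to the bounded solution [y] of [y' + K y = K r + N t r]
   is monotone on the [L]-Lipschitz functions with values in [[a,b]], which
   form a complete lattice: [q] is its largest fixed point (Knaster-Tarski). *)
Lemma entire_solution_in_strip (N : R -> R -> R) (K a b : R) :
  0 < K -> a <= b ->
  (forall t, 0 <= N t a) -> (forall t, N t b <= 0) ->
  (forall t r s, a <= r -> r <= s -> s <= b ->
     K * r + N t r <= K * s + N t s) ->
  (forall r : R -> R, (forall t, a <= r t <= b) ->
     (forall t, continuous r t) -> forall t, continuous (fun s => N s (r s)) t) ->
  exists q : R -> R,
    (forall t, a <= q t <= b) /\ (forall t, is_derive q t (N t (q t))).
Proof.
intros HK Hab Ha Hb Hmono Hcont.
(* Both [K r + N t r] and [K y] lie in [[K a, K b]], so [L] bounds the slope of every image [y]. *)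
set (L := K * (b - a)).
set (lat := fun r : R -> R => (forall t, a <= r t <= b) /\
  (forall x y, Rabs (r y - r x) <= L * Rabs (y - x))).
set (T := fun r y : R -> R =>
  forall t, is_derive y t (K * r t + N t (r t) - K * y t)).
assert (Hrange : forall r, lat r -> forall t,
  K * a <= K * r t + N t (r t) <= K * b).
{ intros r [Hr _] t; destruct (Hr t) as [H1 H2].
  generalize (Hmono t a (r t) (Rle_refl a) H1 H2) (Hmono t (r t) b H1 H2 (Rle_refl b))
    (Ha t) (Hb t); lra. }
assert (Tlat : forall r, lat r -> exists y, lat y /\ T r y).
{ intros r Hr.
  destruct (bounded_linear_ode K a b (fun t => K * r t + N t (r t)))
    as [y [Hy Hyb]]; [exact HK | exact Hab | | apply Hrange, Hr |].
  - destruct Hr as [Hr1 Hr2].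
    assert (Hc := lipschitz_continuous r L Hr2).
    intros t; apply (continuous_plus (fun t => K * r t) (fun t => N t (r t))).
    + apply (continuous_scal_r K r), Hc.
    + apply Hcont; assumption.
  - exists y; split; [split; [exact Hyb |] | exact Hy].
    intros s t; apply (is_derive_lipschitz y _ L s t Hy).
    intros x; generalize (Hrange r Hr x) (Hyb x); intros.
    apply Rabs_le; unfold L; nra. }
assert (Tmono : forall r1 r2 y1 y2, lat r1 -> lat r2 -> lat y1 -> lat y2 ->
  T r1 y1 -> T r2 y2 -> (forall t, r1 t <= r2 t) -> forall t, y1 t <= y2 t).
{ intros r1 r2 y1 y2 [L1 _] [L2 _] [M1 _] [M2 _] T1 T2 Hr t.
  apply Rminus_le_0.
  apply (bounded_linear_ode_nonneg K (b - a) (fun t => y2 t - y1 t)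
    (fun t => (K * r2 t + N t (r2 t) - K * y2 t) -
              (K * r1 t + N t (r1 t) - K * y1 t))); [exact HK | | |].
  - intros s; apply (is_derive_minus y2 y1); [apply T2 | apply T1].
  - intros s.
    generalize (Hmono s (r1 s) (r2 s) (proj1 (L1 s)) (Hr s) (proj2 (L2 s))); lra.
  - intros s; generalize (M1 s) (M2 s); lra. }
(* Post-fixed points: [r] lies below its image, which is given by a witness since [T] is a
   relation. *)
set (post := fun r => lat r /\
  exists y, lat y /\ T r y /\ forall t, r t <= y t).
assert (Hlata : lat (fun _ => a)).
{ split; [intros; lra |]; intros x y.
  rewrite Rminus_diag_eq, Rabs_R0 by reflexivity.
  apply Rmult_le_pos; [unfold L; nra | apply Rabs_pos]. }
assert (Hpost : post (fun _ => a)).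
{ split; [exact Hlata |].
  destruct (Tlat _ Hlata) as [y [Hy HT]].
  exists y; split; [exact Hy | split; [exact HT | intros t; apply Hy]]. }
assert (Hsup : forall t, { m | is_lub (fun x => exists r, post r /\ x = r t) m }).
{ intros t; apply completeness.
  - exists b; intros x [r [[[Hr _] _] ->]]; apply Hr.
  - exists a; exists (fun _ => a); split; [exact Hpost | reflexivity]. }
set (q := fun t => proj1_sig (Hsup t)).
assert (q_ub : forall r, post r -> forall t, r t <= q t).
{ intros r Hr t; unfold q; destruct (Hsup t) as [m [H1 H2]]; simpl.
  apply H1; exists r; split; [exact Hr | reflexivity]. }
assert (q_lub : forall t m, (forall r, post r -> r t <= m) -> q t <= m).
{ intros t m H; unfold q; destruct (Hsup t) as [m' [H1 H2]]; simpl.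
  apply H2; intros x [r [Hr ->]]; apply H, Hr. }
assert (Hq : lat q).
{ split.
  - intros t; split; [apply (q_ub _ Hpost) |].
    apply q_lub; intros r [[Hr _] _]; apply Hr.
  (* A pointwise supremum of [L]-Lipschitz functions is [L]-Lipschitz, so [q] stays in the
     lattice. *)
  - assert (Hle : forall x y, q y <= q x + L * Rabs (y - x)).
    { intros x y; apply q_lub; intros r Hr.
      generalize (q_ub r Hr x) (proj2 (proj1 Hr) x y) (Rle_abs (r y - r x)); lra. }
    intros x y; apply Rabs_le; generalize (Hle x y) (Hle y x).
    rewrite (Rabs_minus_sym x y); lra. }
destruct (Tlat q Hq) as [y [Hy HTy]].
assert (Hqy : forall t, q t <= y t).
{ intros t; apply q_lub; intros r Hr.
  generalize (q_ub r Hr); destruct Hr as [Hr [z [Hz [HTz Hrz]]]]; intros Hrq.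
  apply Rle_trans with (1 := Hrz t).
  apply (Tmono r q z y); assumption. }
(* From [q <= y], monotonicity makes [y] itself post-fixed, hence [y <= q]. *)
assert (Hyq : forall t, y t = q t).
{ intros t; apply Rle_antisym; [| apply Hqy].
  apply q_ub; split; [exact Hy |].
  destruct (Tlat y Hy) as [z [Hz HTz]].
  exists z; split; [exact Hz | split; [exact HTz |]].
  apply (Tmono q y y z); assumption. }
(* The derivative is known for [y], which agrees with [q] only pointwise, so [y] is the witness. *)
exists y; split; [apply Hy |].
intros t; generalize (HTy t); rewrite <- Hyq.
now replace (K * y t + N t (y t) - K * y t) with (N t (y t)) by ring.
Qed.

(** * Inverse functions and change of time *)

(** Difference quotients of [g] are inverses of those of [f], which are at least [m]. Increments of
    [g] are thus at most [|h| / m], which also gives its continuity. *)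
Lemma is_derive_inverse (f g df : R -> R) (m : R) :
  0 < m -> (forall t, m <= df t) -> (forall t, is_derive f t (df t)) ->
  (forall x, f (g x) = x) -> forall x, is_derive g x (/ df (g x)).
Proof.
intros Hm Hdf Hf Hfg x.
assert (Hexp : forall s t, s <= t -> m * (t - s) <= f t - f s).
{ intros s t Hst.
  assert (f s - m * s <= f t - m * t); [| lra].
  apply (is_derive_nonneg_le (fun u => f u - m * u) (fun u => df u - m));
    [| intros u; generalize (Hdf u); lra | exact Hst].
  intros u; apply (is_derive_minus f (fun u => m * u)); [apply Hf |].
  auto_derive; [easy | ring]. }
apply is_derive_Reals; intros eps Heps.
assert (Hlim := proj1 (is_derive_Reals f (g x) (df (g x))) (Hf (g x))).
(* The tolerance comes from [|1/s - 1/D| = |s - D| / (s D)] with [s D >= m * m]. *)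
destruct (Hlim (eps * (m * m))) as [delta Hdelta].
{ apply Rmult_lt_0_compat; [exact Heps | nra]. }
assert (Hmd : 0 < m * delta) by (apply Rmult_lt_0_compat; [exact Hm | apply cond_pos]).
exists (mkposreal _ Hmd); simpl; intros h Hh0 Hh.
set (k := g (x + h) - g x).
assert (Hhk : h = f (g x + k) - f (g x)).
{ unfold k; replace (g x + (g (x + h) - g x)) with (g (x + h)) by ring.
  rewrite !Hfg; ring. }
assert (Hk0 : k <> 0).
{ intros E; rewrite E, Rplus_0_r in Hhk; lra. }
assert (Hslope : m <= h / k).
{ assert (Hk : k = (g x + k) - g x) by ring.
  destruct (Rlt_or_le 0 k) as [H | H].
  - apply Rle_div_r; [exact H |].
    generalize (Hexp (g x) (g x + k)); lra.
  - replace (h / k) with (- h / - k) by (field; exact Hk0).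
    apply Rle_div_r; [lra |].
    generalize (Hexp (g x + k) (g x)); lra. }
assert (Hkd : Rabs k < delta).
{ apply (Rmult_lt_reg_l m); [exact Hm |].
  apply Rle_lt_trans with (2 := Hh).
  replace h with (h / k * k) by (field; exact Hk0).
  rewrite Rabs_mult; apply Rmult_le_compat_r; [apply Rabs_pos |].
  apply Rle_trans with (1 := Hslope); apply Rle_abs. }
specialize (Hdelta k Hk0 Hkd); rewrite <- Hhk in Hdelta.
assert (HD := Hdf (g x)).
set (D := df (g x)) in *; set (s := h / k) in *.
replace (k / h) with (/ s) by (unfold s; field; split; assumption).
replace (/ s - / D) with ((D - s) / (s * D)) by (field; lra).
assert (HsD : m * m <= s * D) by nra.
rewrite Rabs_div, Rabs_minus_sym, (Rabs_pos_eq (s * D)) by nra.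
apply Rlt_div_l; [nra |].
apply Rlt_le_trans with (1 := Hdelta).
apply Rmult_le_compat_l; lra.
Qed.

(* Time change: the orbit of an autonomous equation with speed bounded away
   from 0 is the inverse of its travel time. *)
Lemma autonomous_solution (q : R -> R) (a b : R) :
  0 < a -> (forall t, a <= q t <= b) -> (forall t, continuous q t) ->
  exists tau : R -> R,
    (forall x, is_derive tau x (q (tau x))) /\
    is_lim tau m_infty m_infty /\ is_lim tau p_infty p_infty.
Proof.
intros Ha Hq Hc.
assert (Hb : 0 < b) by (generalize (Hq 0); lra).
assert (Hinv : forall t, / b <= / q t).
{ intros t; generalize (Hq t); intros; apply Rinv_le_contravar; lra. }
assert (Hci : forall t, continuous (fun s => / q s) t).
{ intros t; apply continuous_Rinv_comp; [apply Hc | generalize (Hq t); lra]. }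
set (S := fun t : R => RInt (fun s => / q s) 0 t : R).
assert (HS : forall t, is_derive S t (/ q t)).
{ intros t; apply (is_derive_RInt_continuous (fun s => / q s)), Hci. }
assert (S0 : S 0 = 0) by exact (RInt_point 0 (fun s => / q s)).
assert (Hmono : forall s t, s <= t -> S s - / b * s <= S t - / b * t).
{ intros s t Hst.
  apply (is_derive_nonneg_le (fun u => S u - / b * u) (fun u => / q u - / b));
    [| intros u; generalize (Hinv u); lra | exact Hst].
  intros u; apply (is_derive_minus S (fun u => / b * u)); [apply HS |].
  auto_derive; [easy | ring]. }
(* As [S] vanishes at 0 and has slope at least [/ b], it takes the value [x] within distance [b |x|]
   of 0. The sigma type lets [tau] be defined as a function. *)
assert (Hsurj : forall x, { t | S t = x }).
{ intros x; apply constructive_indefinite_description.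
  destruct (IVT_gen S (- (b * Rabs x)) (b * Rabs x) x) as [t [_ Ht]].
  - intros t; apply derivable_continuous_pt; exists (/ q t).
    apply is_derive_Reals, HS.
  - assert (Hbx : 0 <= b * Rabs x)
      by (apply Rmult_le_pos; [lra | apply Rabs_pos]).
    assert (E : / b * (b * Rabs x) = Rabs x) by (field; lra).
    generalize (Hmono (- (b * Rabs x)) 0) (Hmono 0 (b * Rabs x))
      (Rle_abs x) (Rle_abs (- x)).
    rewrite S0, Rabs_Ropp; intros.
    rewrite Rmin_left, Rmax_right; lra.
  - now exists t. }
set (tau := fun x => proj1_sig (Hsurj x)).
assert (Htau : forall x, is_derive tau x (q (tau x))).
{ intros x; rewrite <- (Rinv_inv (q (tau x))).
  apply (is_derive_inverse S tau (fun t => / q t) (/ b)); trivial.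
  - apply Rinv_0_lt_compat, Hb.
  - intros y; apply (proj2_sig (Hsurj y)). }
(* The speed of [tau] is at least [a]; both infinite limits follow from this linear growth. *)
assert (Hgrow : forall x y, x <= y -> tau x - a * x <= tau y - a * y).
{ intros x y Hxy.
  apply (is_derive_nonneg_le (fun u => tau u - a * u) (fun u => q (tau u) - a));
    [| intros u; generalize (Hq (tau u)); lra | exact Hxy].
  intros u; apply (is_derive_minus tau (fun u => a * u)); [apply Htau |].
  auto_derive; [easy | ring]. }
exists tau; split; [exact Htau | split].
- intros P [M HM]; exists (Rmin 0 ((M - tau 0) / a)); intros x Hx.
  apply HM.
  assert (H0 : x < 0) by (apply Rlt_le_trans with (1 := Hx), Rmin_l).
  assert (H1 : x < (M - tau 0) / a) by (apply Rlt_le_trans with (1 := Hx), Rmin_r).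
  apply Rlt_div_r in H1; [| exact Ha].
  generalize (Hgrow x 0); lra.
- intros P [M HM]; exists (Rmax 0 ((M - tau 0) / a)); intros x Hx.
  apply HM.
  assert (H0 : 0 < x) by (apply Rle_lt_trans with (2 := Hx), Rmax_l).
  assert (H1 : (M - tau 0) / a < x) by (apply Rle_lt_trans with (2 := Hx), Rmax_r).
  apply Rlt_div_l in H1; [| exact Ha].
  generalize (Hgrow 0 x); lra.
Qed.

(** * The logistic curve *)

Definition logistic (t : R) : R := / (1 + exp t).

Lemma logistic_bounds (t : R) : 0 < logistic t < 1.
Proof.
unfold logistic; generalize (exp_pos t); intros; split.
- apply Rinv_0_lt_compat; lra.
- rewrite <- Rinv_1; apply Rinv_lt_contravar; lra.
Qed.

Lemma is_derive_logistic (t : R) :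
  is_derive logistic t (- (logistic t * (1 - logistic t))).
Proof.
generalize (exp_pos t); intros; unfold logistic; auto_derive; [lra | field; lra].
Qed.

Lemma is_lim_logistic_p : is_lim logistic p_infty 0.
Proof.
change (Finite 0) with (Rbar_inv p_infty).
apply is_lim_inv; [| easy].
apply (is_lim_plus (fun _ => 1) exp p_infty 1 p_infty);
  [apply is_lim_const | apply is_lim_exp_p | easy].
Qed.

Lemma is_lim_logistic_m : is_lim logistic m_infty 1.
Proof.
replace (Finite 1) with (Rbar_inv 1) by (simpl; now rewrite Rinv_1).
apply is_lim_inv; [| intros E; injection E; lra].
replace (Finite 1) with (Finite (1 + 0)) by (now rewrite Rplus_0_r).
apply (is_lim_plus (fun _ => 1) exp m_infty 1 0);
  [apply is_lim_const | apply is_lim_exp_m | easy].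
Qed.

(** * The slope equation and its invariant strip *)

Lemma pow_le_id (v : R) (k : nat) :
  (0 < k)%nat -> 0 <= v <= 1 -> 0 <= v ^ k <= v.
Proof.
intros Hk Hv; destruct k as [| k]; [inversion Hk |]; simpl.
generalize (pow_le v k (proj1 Hv)) (pow_incr v 1 k Hv).
rewrite pow1; nra.
Qed.

(** The bound [q <= 1] is the parabola barrier; the positive lower bound keeps [/ q] bounded and
    later keeps the time change from stalling. *)
Lemma profile_slope_exists (c : R) (k : nat) (H : R -> R) :
  2 <= c -> (0 < k)%nat -> (forall v, continuous H v) ->
  (forall v, 0 <= v <= 1 -> 1 <= H v <= 1 + v) ->
  exists q : R -> R,
    (forall t, / (c + 1) <= q t <= 1) /\
    (forall t, is_derive q t
       ((1 - 2 * logistic t) * q t - (c - logistic t ^ k)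
        + H (logistic t) / q t)).
Proof.
intros hc hk Hcont HH.
set (e := / (c + 1)).
assert (He : 0 < e) by (apply Rinv_0_lt_compat; lra).
assert (Hce : (c + 1) * e = 1) by (unfold e; field; lra).
assert (Hie : / e = c + 1) by apply Rinv_inv.
assert (Hlog : forall t, 0 <= logistic t <= 1)
  by (intros t; generalize (logistic_bounds t); lra).
assert (Hlogc : forall t, continuous logistic t).
{ intros t; apply (ex_derive_continuous logistic); eexists; apply is_derive_logistic. }
(* In [r] the field has derivative [(1 - 2 u) - H / r^2 >= - 1 - 2 (c + 1)^2], because [H <= 2] and
   [r >= / (c + 1)]. This [K] compensates it. *)
apply (entire_solution_in_strip
  (fun t r => (1 - 2 * logistic t) * r - (c - logistic t ^ k) + H (logistic t) / r)
  (1 + 2 * (c + 1) ^ 2) e 1).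
- nra.
- nra.
(* At [r = e] the field is at least [- e - c + (c + 1) = 1 - e], using [H >= 1]. *)
- intros t; generalize (HH _ (Hlog t)) (pow_le_id _ k hk (Hlog t)) (Hlog t).
  unfold Rdiv; rewrite Hie; nra.
(* At [r = 1] the field is at most [(1 - 2 u) - c + u + (1 + u) = 2 - c]: here [c >= 2] enters. *)
- intros t; generalize (HH _ (Hlog t)) (pow_le_id _ k hk (Hlog t)) (Hlog t).
  unfold Rdiv; rewrite Rinv_1; nra.
- intros t r s Hr Hrs Hs.
  generalize (HH _ (Hlog t)) (Hlog t).
  set (h := H (logistic t)); set (v := logistic t); intros Hh Hv.
  assert (Hir : / r <= c + 1)
    by (rewrite <- Hie; apply Rinv_le_contravar; lra).
  assert (His : / s <= c + 1)
    by (rewrite <- Hie; apply Rinv_le_contravar; lra).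
  assert (Hir0 : 0 < / r) by (apply Rinv_0_lt_compat; lra).
  assert (His0 : 0 < / s) by (apply Rinv_0_lt_compat; lra).
  assert (E : h / r - h / s = h * (/ r * / s) * (s - r)) by (field; lra).
  assert (Hrs2 : / r * / s <= (c + 1) ^ 2) by nra.
  assert (Hrs0 : 0 < / r * / s) by nra.
  assert (Hh2 : h * (/ r * / s) <= 2 * (c + 1) ^ 2) by nra.
  assert (h * (/ r * / s) * (s - r) <= 2 * (c + 1) ^ 2 * (s - r))
    by (apply Rmult_le_compat_r; lra).
  nra.
- intros r Hr Hrc t.
  apply (continuous_plus
    (fun s => (1 - 2 * logistic s) * r s - (c - logistic s ^ k))
    (fun s => H (logistic s) / r s)).
  + apply (continuous_minus (fun s => (1 - 2 * logistic s) * r s)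
      (fun s => c - logistic s ^ k)).
    * apply (continuous_mult (fun s => 1 - 2 * logistic s) r); [| apply Hrc].
      apply (ex_derive_continuous (fun s => 1 - 2 * logistic s)); auto_derive.
      eexists; apply is_derive_logistic.
    * apply (ex_derive_continuous (fun s => c - logistic s ^ k)); auto_derive.
      eexists; apply is_derive_logistic.
  + apply (continuous_mult (fun s => H (logistic s)) (fun s => / r s)).
    * apply (continuous_comp logistic H); [apply Hlogc | apply Hcont].
    * apply continuous_Rinv_comp; [apply Hrc | generalize (Hr t); lra].
Qed.

(** [H] is [(1 - v^n) / (1 - v)] with its singularity at 1 removed; its bound [1 + v] is what the
    upper barrier requires. *)
Lemma reaction_factor (n : nat) :
  n = 1%nat \/ n = 2%nat ->
  exists H : R -> R, (forall v, continuous H v) /\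
    (forall v, 0 <= v <= 1 -> 1 <= H v <= 1 + v) /\
    (forall v, v * (1 - v) * H v = v * (1 - v ^ n)).
Proof.
intros [-> | ->].
- exists (fun _ => 1); split; [intros; apply continuous_const | split].
  + intros; lra.
  + intros; ring.
- exists (fun v => 1 + v); split; [| split].
  + intros v; apply (ex_derive_continuous (fun v => 1 + v)); auto_derive; easy.
  + intros; lra.
  + intros; ring.
Qed.

(** * From the planar orbit to the traveling wave *)

Lemma traveling_wave_pde_solution (k n : nat) (c : R) (phi psi : R -> R) :
  (forall x, 0 <= phi x <= 1) -> planar_solution (planar_field k n c) phi psi ->
  pde_solution k n (fun z t => phi (z - c * t)).
Proof.
intros Hphi Hsol; split; [intros; apply Hphi |].
intros z t.
assert (Hz : forall y, is_derive (fun y => phi (y - c * t)) y (psi (y - c * t))).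
{ intros y; destruct (Hsol (y - c * t)) as [Hd _]; simpl in Hd.
  auto_derive; [eexists; apply Hd |].
  change (y + - (c * t)) with (y - c * t).
  rewrite (is_derive_unique (fun x : R => phi x) _ _ Hd); ring. }
destruct (Hsol (z - c * t)) as [Hd1 Hd2]; simpl in Hd1, Hd2.
exists (- c * psi (z - c * t)), (psi (z - c * t)).
(* The value of [w_zz] is left open; the second equation of the system supplies it. *)
eexists; split; [| split; [apply Hz | split]].
- auto_derive; [eexists; apply Hd1 |].
  change (z + - (c * t)) with (z - c * t).
  rewrite (is_derive_unique (fun x : R => phi x) _ _ Hd1); ring.
- simpl; apply (is_derive_ext (fun y => psi (y - c * t))).
  + intros y; symmetry; apply is_derive_unique, Hz.
  + auto_derive; [eexists; apply Hd2 |].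
    change (z + - (c * t)) with (z - c * t).
    rewrite (is_derive_unique (fun x : R => psi x) _ _ Hd2).
    apply Rmult_1_l.
- simpl; ring.
Qed.

Theorem theorem2 (c : R) (n k : nat)
  (hc : 2 <= c) (hn : n = 1%nat \/ n = 2%nat) (hk : (0 < k)%nat) :
  exists (w : R -> R -> R) (phi psi : R -> R),
    pde_solution k n w /\
    (forall z t : R, w z t = phi (z - c * t)) /\
    (forall xi : R, 0 <= phi xi <= 1) /\
    planar_solution (planar_field k n c) phi psi /\
    connects (planar_field k n c) phi psi (1, 0) (0, 0) /\
    is_lim phi m_infty 1 /\
    is_lim phi p_infty 0 /\
    is_lim (Derive phi) m_infty 0 /\
    is_lim (Derive phi) p_infty 0.
Proof.
destruct (reaction_factor n hn) as [H [Hc [HH Hfac]]].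
destruct (profile_slope_exists c k H hc hk Hc HH) as [q [Hq Hq']].
destruct (autonomous_solution q (/ (c + 1)) 1) as [tau [Htau [Htm Htp]]].
{ apply Rinv_0_lt_compat; lra. }
{ exact Hq. }
{ intros t; apply (ex_derive_continuous q); eexists; apply Hq'. }
set (phi := fun x => logistic (tau x)).
(* This is [phi'] by the chain rule, from [u' = - u (1 - u)] and [tau' = q (tau)]. *)
set (psi := fun x => - (phi x * (1 - phi x) * q (tau x))).
assert (Hphi01 : forall x, 0 < phi x < 1) by (intros; apply logistic_bounds).
assert (Hphi : forall x, is_derive phi x (psi x)).
{ intros x; unfold phi at 1.
  replace (psi x) with (q (tau x) * - (phi x * (1 - phi x))) by (unfold psi; ring).
  apply (is_derive_comp logistic tau); [apply is_derive_logistic | apply Htau]. }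
assert (Hq0 : forall t, 0 < q t).
{ intros t; apply Rlt_le_trans with (2 := proj1 (Hq t)).
  apply Rinv_0_lt_compat; lra. }
assert (Hsol : planar_solution (planar_field k n c) phi psi).
{ intros x; split; simpl; [apply Hphi |].
  assert (Hqt := is_derive_comp q tau x _ _ (Hq' (tau x)) (Htau x)).
  set (d := scal _ _) in Hqt.
  (* The right-hand side is put in the form given by the product rule; the two terms in
     [(1 - 2 phi) q^2] cancel, and the factor [q] from the time change absorbs the division in
     [H / q]. *)
  replace (- c * psi x + phi x ^ k * psi x + phi x * (phi x ^ n - 1))
    with (- ((psi x * (1 - phi x) + phi x * - psi x) * q (tau x)
             + phi x * (1 - phi x) * d)).
  - unfold psi at 1; set (Q := fun x => q (tau x)) in *.
    apply (is_derive_ext (fun x => - (phi x * (1 - phi x) * Q x)));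
      [reflexivity |].
    auto_derive.
    + repeat split; eexists; try apply Hphi; apply Hqt.
    + rewrite (is_derive_unique (fun x : R => phi x) _ _ (Hphi x)).
      rewrite (is_derive_unique (fun x : R => Q x) _ _ Hqt).
      change (q (tau x)) with (Q x); ring.
  - replace (phi x * (phi x ^ n - 1)) with (- (phi x * (1 - phi x) * H (phi x)))
      by (rewrite Hfac; ring).
    unfold d, psi, phi, scal; simpl; unfold mult; simpl.
    generalize (Hq0 (tau x)); intros; field; lra. }
assert (Hphi_m : is_lim phi m_infty 1).
{ apply (is_lim_comp logistic tau m_infty 1 m_infty); [apply is_lim_logistic_m | exact Htm |].
  now exists 0. }
assert (Hphi_p : is_lim phi p_infty 0).
{ apply (is_lim_comp logistic tau p_infty 0 p_infty); [apply is_lim_logistic_p | exact Htp |].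
  now exists 0. }
(* Since [q <= 1], [|psi| <= phi (1 - phi)]. Each factor gives the squeeze at one end: [1 - phi] at
   minus infinity, [phi] at plus infinity. *)
assert (Hpsi : forall x, - phi x <= psi x <= 0 /\ - (1 - phi x) <= psi x).
{ intros x; unfold psi.
  generalize (Hphi01 x) (Hq (tau x)) (Hq0 (tau x)).
  generalize (phi x) (q (tau x)); intros v r Hv [_ Hr1] Hr0.
  assert (0 <= v * (1 - v)) by nra.
  assert (v * (1 - v) * r <= v * (1 - v)) by nra.
  repeat split; nra. }
assert (Hpsi_m : is_lim psi m_infty 0).
{ apply (is_lim_le_le_loc (fun x => phi x - 1) (fun _ => 0)).
  - exists 0; intros x _; generalize (Hpsi x); lra.
  - replace (Finite 0) with (Finite (1 - 1)) by (now rewrite Rminus_diag_eq).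
    apply (is_lim_minus phi (fun _ => 1) m_infty 1 1);
      [exact Hphi_m | apply is_lim_const | easy].
  - apply is_lim_const. }
assert (Hpsi_p : is_lim psi p_infty 0).
{ apply (is_lim_le_le_loc (fun x => - phi x) (fun _ => 0)).
  - exists 0; intros x _; generalize (Hpsi x); lra.
  - replace (Finite 0) with (Rbar_opp 0) by (simpl; now rewrite Ropp_0).
    apply (is_lim_opp phi p_infty 0), Hphi_p.
  - apply is_lim_const. }
assert (HD : forall x, psi x = Derive phi x)
  by (intros; symmetry; apply is_derive_unique, Hphi).
assert (Hphi01' : forall x, 0 <= phi x <= 1)
  by (intros x; generalize (Hphi01 x); lra).
exists (fun z t => phi (z - c * t)), phi, psi.
split; [now apply traveling_wave_pde_solution with psi |].
split; [reflexivity |].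
split; [exact Hphi01' |].
split; [exact Hsol |].
split.
- repeat split; try assumption; unfold equilibrium; simpl; f_equal.
  + rewrite !pow1; ring.
  + rewrite (pow_i n) by (destruct hn; subst n; auto); ring.
- repeat split; try assumption.
  + now apply (is_lim_ext psi).
  + now apply (is_lim_ext psi).
Qed.
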